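(* Let $1\le m\le n-1$ be integers. For any real number $s$ with $m<s\le n$ there is a positive number $p_0=p_0(n,m,s)$ such that for any prime number $p\ge p_0$ there exists a subset $E\subset\mathbb{F}_p^n$ with $p^{s}/2\le |E|\le 2p^{s}$ such that $$|\pi^{W}(E)|=p^{m}\quad\text{for all } W\in G(n,n-m).$$
   Context: $\mathbb{F}_p$ is the field with $p$ elements ($p$ prime). $|J|$ denotes the cardinality of a finite set $J$. $G(n,k)$ denotes the set of all $k$-dimensional linear subspaces of $\mathbb{F}_p^n$. For a subspace $W$ of $\mathbb{F}_p^n$ and $E\subset\mathbb{F}_p^n$, $\pi^W(E)$ is the set of cosets of $W$ that meet $E$: $$\pi^{W}(E)=\{x+W: x\in\mathbb{F}_p^n,\ E\cap(x+W)\ne\emptyset\}.$$ *)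

(* Defs.v *)
From mathcomp Require Import all_boot all_order all_algebra.
From mathcomp Require Import all_reals exp.

Set Implicit Arguments.
Unset Strict Implicit.
Unset Printing Implicit Defensive.

Import GRing.Theory.
Local Open Scope ring_scope.

Section Projections.
Variables (p n : nat).

Definition vcoset (x : 'rV['F_p]_n) (W : {vspace 'rV['F_p]_n}) :
    {set 'rV['F_p]_n} :=
  [set x + w | w in W].

Definition proj (W : {vspace 'rV['F_p]_n}) (E : {set 'rV['F_p]_n}) :
    {set {set 'rV['F_p]_n}} :=
  [set vcoset x W | x : 'rV['F_p]_n & E :&: vcoset x W != set0].

Definition G (k : nat) : pred {vspace 'rV['F_p]_n} := [pred W | \dim W == k].

End Projections.

Arguments G : clear implicits.

(* Main.v *)
(* A random set of [N] points misses a fixed coset of size [p^(n-m)] with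
   probability at most [exp (- N / p^m)].  There are at most [p^(n(n-m+1))]
   cosets of (n-m)-dimensional subspaces, so for [N] close to [p^s], where
   [N / p^m] is of order [p^(s-m)] and thus dominates [ln p], the union bound
   yields a set meeting every coset of every such subspace. *)
Require Import Defs.
From mathcomp Require Import all_boot all_order all_algebra.
From mathcomp Require Import finfield ring lra.
From mathcomp Require Import all_reals sequences exp.

Set Implicit Arguments.
Unset Strict Implicit.
Unset Printing Implicit Defensive.

Import Order.TTheory GRing.Theory Num.Theory.
Local Open Scope ring_scope.

Lemma set_extend_card (T : finType) (E : {set T}) (N : nat) :
  (#|E| <= N <= #|T|)%N -> exists2 E' : {set T}, E \subset E' & #|E'| = N.
Proof.
move=> /andP[EN NT].
have : (N - #|E| <= #|~: E|)%N by rewrite [#|~: E|]cardsCs setCK leq_sub2r.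
move=> /card_geqP[s [s_uniq sz_s sE]]; exists (E :|: [set x in s]).
  exact: subsetUl.
rewrite cardsU cardsE (card_uniqP s_uniq) sz_s subnKC//.
suff -> : E :&: [set x in s] = set0 by rewrite cards0 subn0.
apply/setP => x; rewrite !inE; apply/negP => /andP[xE /sE].
by rewrite inE xE.
Qed.

(** Probability is replaced by counting maps [f : 'I_N -> T], that is, [N] independent draws with
    repetition. At most [(#|T| - K) ^ N] of them avoid a given [A i], so some map avoids none. Its
    image may have fewer than [N] points, and enlarging it to exactly [N] preserves the hits. *)
Lemma hitting_set_card (T I : finType) (A : I -> {set T}) (K N : nat) :
  (forall i, K <= #|A i|)%N -> (N <= #|T|)%N ->
  (#|I| * (#|T| - K) ^ N < #|T| ^ N)%N ->
  exists E : {set T}, #|E| = N /\ forall i, E :&: A i != set0.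
Proof.
move=> KA NT cardI.
pose miss i : pred {ffun 'I_N -> T} := ffun_on (mem (~: A i)).
have card_miss i : (#|miss i| <= (#|T| - K) ^ N)%N.
  rewrite card_ffun_on card_ord.
  have : (#|~: A i| <= #|T| - K)%N by rewrite cardsCs setCK leq_sub2l.
  by case: N {NT cardI miss} => // N; rewrite leq_exp2r.
have [f /forallP hitf] : exists f : {ffun 'I_N -> T}, [forall i, f \notin miss i].
  (* If every [f] lay in some [miss i], counting the pairs [(i, f)] with [f] in [miss i] would give
     [#|T| ^ N <= #|I| * (#|T| - K) ^ N]. *)
  apply/existsP; apply: contraLR cardI => /existsPn all_miss; rewrite -leqNgt.
  have -> : (#|T| ^ N = #|{ffun 'I_N -> T}|)%N by rewrite card_ffun card_ord.
  rewrite -sum_nat_const -sum1_card.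
  apply: (@leq_trans (\sum_(i : I) #|miss i|)); last exact: leq_sum.
  under [leqRHS]eq_bigr do rewrite -sum1_card.
  rewrite (exchange_big_dep xpredT) //=; apply: leq_sum => f _.
  rewrite sum1_card; apply/card_gt0P.
  have /forallPn[i] := all_miss f; rewrite negbK => fi.
  by exists i.
have cardf : (#|[set f u | u : 'I_N]| <= N <= #|T|)%N.
  by rewrite NT andbT (leq_trans (leq_imset_card _ _))// card_ord.
have [E sE cardE] := set_extend_card cardf.
exists E; split=> // i; apply/set0Pn.
have := hitf i; rewrite /miss => /ffun_onP fi.
have [u uA] : exists u, f u \in A i.
  apply/existsP; apply: contra_notT fi => /existsPn fi u.
  by rewrite inE fi.
by exists (f u); rewrite inE uA andbT (subsetP sE)// imset_f.
Qed.

(* Union bound, with the proportion of misses estimated by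
   [(1 - K / |T|)^N <= exp (- N K / |T|)]. *)
Lemma hitting_set_expR (R : realType) (T I : finType) (A : I -> {set T})
    (K N : nat) :
  (0 < #|T|)%N -> (K <= #|T|)%N -> (forall i, K <= #|A i|)%N -> (N <= #|T|)%N ->
  #|I|%:R < expR (N%:R * (K%:R / #|T|%:R) : R) ->
  exists E : {set T}, #|E| = N /\ forall i, E :&: A i != set0.
Proof.
move=> T0 KT KA NT cardI; apply: hitting_set_card KA NT _.
rewrite -(ltr_nat R) natrM !natrX natrB//.
have T0R : 0 < #|T|%:R :> R by rewrite ltr0n.
set r : R := K%:R / #|T|%:R in cardI.
have -> : #|T|%:R - K%:R = #|T|%:R * (1 - r) :> R.
  by rewrite /r mulrBr mulr1 mulrCA divff ?gt_eqF// mulr1.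
have r1 : 0 <= 1 - r.
  by rewrite subr_ge0 ler_pdivrMr ?mul1r ?ler_nat.
rewrite exprMn mulrCA gtr_pMr ?exprn_gt0//.
apply: le_lt_trans (_ : #|I|%:R * expR (- r) ^+ N < 1).
  by rewrite ler_wpM2l// lerXn2r ?nnegrE ?expR_ge0// expR_ge1Dx.
by rewrite -expRM_natl mulrN expRN ltr_pdivrMr ?expR_gt0// mul1r.
Qed.

Lemma ln_lt_powR (R : realType) (a c : R) : 0 < a ->
  exists2 x0 : R, 0 < x0 & forall x, x0 <= x -> c * ln x < x `^ a.
Proof.
move=> a0; exists ((2 * `|c| / a) `^ (2 / a) + 1).
  by rewrite ltr_wpDl ?powR_ge0.
move=> x xge; set b : R := a / 2.
have b0 : 0 < b by rewrite divr_gt0.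
have x1 : 1 <= x by apply: le_trans xge; rewrite lerDr powR_ge0.
have x0 : 0 < x by lra.
have lnx : b * ln x < x `^ b by rewrite -ln_powR ln_sublinear ?powR_gt0.
have cx : `|c| / b <= x `^ b.
  have -> : `|c| / b = 2 * `|c| / a by rewrite /b; field; rewrite gt_eqF.
  have d0 : 0 <= 2 * `|c| / a by rewrite divr_ge0 ?mulr_ge0 ?(ltW a0).
  have ab : 2 / a * b = 1 by rewrite /b; field; rewrite gt_eqF.
  have <- : ((2 * `|c| / a) `^ (2 / a)) `^ b = 2 * `|c| / a.
    by rewrite -powRrM ab powRr1.
  by rewrite ge0_ler_powR ?nnegrE ?powR_ge0 ?ltW//; lra.
have -> : x `^ a = x `^ b * x `^ b.
  have abb : a = b + b by rewrite /b; lra.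
  by rewrite [in LHS]abb powRD// (gt_eqF x0) implybT.
apply: le_lt_trans (_ : `|c| * ln x < _).
  by rewrite ler_wpM2r ?ln_ge0 ?ler_norm.
have -> : `|c| * ln x = (`|c| / b) * (b * ln x) by field; rewrite gt_eqF.
apply: le_lt_trans (_ : x `^ b * (b * ln x) < _).
  by rewrite ler_wpM2r// mulr_ge0 ?ln_ge0// ltW.
by rewrite ltr_pM2l ?powR_gt0.
Qed.

Section Cosets.
Variables (p n : nat).
Hypothesis p_pr : prime p.
Implicit Types (W : {vspace 'rV['F_p]_n}) (x y : 'rV['F_p]_n).

Lemma mem_vcoset x y W : (y \in vcoset x W) = (y - x \in W).
Proof.
apply/imsetP/idP => [[w wW ->]|yxW]; first by rewrite addrC addKr.
by exists (y - x) => //; rewrite addrC subrK.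
Qed.

Lemma vcoset_eqP x y W : (vcoset y W == vcoset x W) = (y \in vcoset x W).
Proof.
apply/eqP/idP => [<-|]; first by rewrite mem_vcoset subrr mem0v.
rewrite mem_vcoset => yxW; apply/setP => z; rewrite !mem_vcoset.
by rewrite -(rpredDr _ yxW) addrA subrK.
Qed.

Lemma card_vcoset x W : #|vcoset x W| = (p ^ \dim W)%N.
Proof.
by rewrite card_imset ?card_vspace ?card_Fp //; apply: addrI.
Qed.

Lemma card_vcosets W :
  (#|[set vcoset x W | x in [set: 'rV['F_p]_n]]| * p ^ \dim W = p ^ n)%N.
Proof.
have <- : (\sum_(x in [set: 'rV['F_p]_n]) 1 = p ^ n)%N.
  by rewrite sum1_card cardsT card_mx card_Fp// mul1n.
(* The fibre of [x |-> vcoset x W] over a coset is that coset itself, so all fibres have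
   [p ^ \dim W] elements. *)
rewrite (partition_big_imset (fun x => vcoset x W)) /=.
rewrite -sum_nat_const; apply: eq_bigr => _ /imsetP[x _ ->].
rewrite -(card_vcoset x W) -sum1_card; apply: eq_bigl => y.
by rewrite inE vcoset_eqP.
Qed.

Lemma card_proj_full k E W : W \in G p n k ->
  (forall x, E :&: vcoset x W != set0) -> (#|proj W E| * p ^ k = p ^ n)%N.
Proof.
rewrite inE => /eqP <- hitE; rewrite -(card_vcosets W); congr (#|pred_of_set _| * _)%N.
by apply/setP => C; apply/imsetP/imsetP => -[x _ ->]; exists x; rewrite ?inE ?hitE.
Qed.

End Cosets.

Theorem theorem1p6 (R : realType) (n m : nat)
    (hm : (1 <= m)%N) (hmn : (m <= n - 1)%N) (s : R)
    (hms : m%:R < s) (hsn : s <= n%:R) :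
  exists2 p0 : R, 0 < p0 &
    forall p : nat, prime p -> p0 <= p%:R ->
      exists E : {set 'rV['F_p]_n},
        [/\ p%:R `^ s / 2 <= #|E|%:R,
            #|E|%:R <= 2 * p%:R `^ s
          & forall W : {vspace 'rV['F_p]_n}, W \in G p n (n - m)%N ->
              #|proj W E| = (p ^ m)%N].
Proof.
pose k := (n - m)%N.
have mn : (m <= n)%N by rewrite (leq_trans hmn)// leq_subr.
have nE : n = (k + m)%N by rewrite subnK.
have sm0 : 0 < s - m%:R by rewrite subr_gt0.
(* There will be [p ^ (n * k.+1)] indices in the union bound; the factor 2 pays for the rounding
   loss [q / 2 <= N]. *)
have [x0 x00 ln_lt] := ln_lt_powR (2 * (n * k.+1)%:R) sm0.
exists x0 => // p p_pr x0p.
have p0 : 0 < p%:R :> R by rewrite ltr0n prime_gt0.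
have p1 : 1 <= p%:R :> R by rewrite ler1n prime_gt0.
pose q : R := p%:R `^ s; pose N := Num.truncn q.
have q1 : 1 <= q.
  by rewrite -(powRr0 p%:R) ler_powR// (le_trans _ (ltW hms)).
have /andP[Nq qN] : N%:R <= q < N.+1%:R by rewrite truncn_itv// (le_trans _ q1).
have N1 : 1 <= N%:R :> R.
  by rewrite ler1n -ltnS -(ltr_nat R) (le_lt_trans q1).
have qN2 : q / 2 <= N%:R by move: qN; rewrite -natr1; lra.
have Npn : (N <= p ^ n)%N.
  rewrite -(ler_nat R) natrX (le_trans Nq)// -powR_mulrn ?(ltW p0)//.
  by rewrite ler_powR.
pose V := 'rV['F_p]_n.
have cardV : #|{: V}| = (p ^ n)%N by rewrite card_mx card_Fp// mul1n.
(* Subspaces are indexed by [k]-tuples of vectors, which makes the index count immediate. A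
   dependent tuple gets the whole space, so the lower bound [p ^ k] holds for every index. *)
pose A (i : V * k.-tuple V) :=
  if free i.2 then vcoset i.1 <<i.2>>%VS else setT.
have cardA i : (p ^ k <= #|A i|)%N.
  rewrite /A; case: ifPn => [/eqP free_b|_].
    by rewrite card_vcoset// free_b size_tuple.
  by rewrite cardsT cardV leq_pexp2l ?prime_gt0// leq_subr.
have [E [cardE hitE]] : exists E : {set V}, #|E| = N /\ forall i, E :&: A i != set0.
  apply: (@hitting_set_expR R _ _ A (p ^ k) N) => //; rewrite ?cardV//.
  - by rewrite expn_gt0 prime_gt0.
  - by rewrite leq_pexp2l ?prime_gt0// leq_subr.
  have -> : (p ^ k)%:R / (p ^ n)%:R = (p%:R `^ m%:R)^-1 :> R.
    rewrite powR_mulrn ?ltW// nE expnD natrM invfM mulrA.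
    rewrite divff ?mul1r ?natrX//.
    by rewrite expf_neq0 ?gt_eqF.
  rewrite card_prod card_tuple cardV -expnM -expnD -mulnS natrX.
  rewrite -[ltLHS]lnK ?posrE ?exprn_gt0// ltr_expR lnXn// -[ltLHS]mulr_natl.
  apply: (@lt_le_trans _ _ (q / 2 / p%:R `^ m%:R)); last first.
    by rewrite ler_wpM2r ?invr_ge0 ?powR_ge0.
  have := ln_lt _ x0p; rewrite powRB ?gt_eqF ?implybT//.
  by rewrite -/q; lra.
exists E; rewrite cardE; split=> //.
  by rewrite (le_trans Nq)// -/q; lra.
move=> W GW; have hitW x : E :&: vcoset x W != set0.
  have dimW : \dim W = k by apply/eqP.
  (* A basis of [W] is a free tuple spanning [W], so [A (x, b)] is the coset [x + W]. *)
  pose b : k.-tuple V := tcast dimW (vbasis W).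
  have := hitE (x, b); rewrite /A /= val_tcast.
  by rewrite (basis_free (vbasisP W)) (span_basis (vbasisP W)).
have := card_proj_full p_pr GW hitW.
rewrite [in RHS]nE addnC expnD => /eqP.
by rewrite eqn_pmul2r ?expn_gt0 ?prime_gt0// => /eqP.
Qed.
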